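(* For every integer $n\ge 1$, $$B_n(q)=\prod_{k=1}^{n-1}(1-q^k)^{n-k},$$ where $B_n(q)=\sum_{w\in S_n}(-1)^{\ell(w)}q^{\beta(w)}$ is the $n$-th signed bigrassmannian polynomial in the indeterminate $q$.
   Context: $S_n$ is the symmetric group on $[n]=\{1,\dots,n\}$. For $w\in S_n$, the set of inversions is $N(w)=\{(i,j)\in[n]\times[n]\mid i<j \text{ and } w^{-1}(i)>w^{-1}(j)\}$, the length is $\ell(w)=|N(w)|$, and the bigrassmannian statistic is $\beta(w)=\sum_{(i,j)\in N(w)}(j-i)$. An empty product equals $1$. *)

(* Defs.v *)
From mathcomp Require Import all_boot all_order all_fingroup all_algebra.

Set Implicit Arguments.
Unset Strict Implicit.
Unset Printing Implicit Defensive.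

Import GRing.Theory.
Local Open Scope ring_scope.

(* The set [n] = {1, ..., n} is represented by 'I_n = {0, ..., n - 1}; the
   shift by one changes neither the order nor the differences j - i. *)

Definition inversions (n : nat) (w : 'S_n) : {set 'I_n * 'I_n} :=
  [set p : 'I_n * 'I_n |
    (p.1 < p.2)%N && ((w^-1)%g p.2 < (w^-1)%g p.1)%N].

Definition perm_length (n : nat) (w : 'S_n) : nat := #|inversions w|.

(* Truncated subtraction is exact here, since p.1 < p.2 for an inversion p. *)
Definition bigrassmannian_stat (n : nat) (w : 'S_n) : nat :=
  (\sum_(p in inversions w) (p.2 - p.1))%N.

Definition signed_bigrassmannian_poly (n : nat) : {poly int} :=
  \sum_(w : 'S_n) (-1) ^+ perm_length w * 'X^(bigrassmannian_stat w).

(* Main.v *)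
Require Import Defs.
From mathcomp Require Import all_boot all_order all_fingroup all_algebra.

Import GRing.Theory.
Local Open Scope ring_scope.

(** Up to reversal, [B_n] is a Vandermonde determinant. Counting pairs gives
    [bigrassmannian_stat w + \sum_i i * w^-1 i = \sum_i i ^ 2], so that, after
    multiplication by the power [q ^ (\sum_i i * (n - 1 - i))], the sum defining
    [B_n] becomes the Leibniz expansion of the Vandermonde determinant at the
    points [q ^ (n - 1 - j)]. The factor of a pair [i < j] in the product
    formula is [q ^ (n - 1 - j) * (1 - q ^ (j - i))], and the monomials
    multiply to that same power of [q]. *)

(** Permuting the points permutes the columns of the Vandermonde matrix, so its determinant picks up
    the sign of [u]. *)
Lemma det_Vandermonde_perm (R : comNzRingType) (n : nat) (a : 'rV[R]_n)
    (u : 'S_n) :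
  \prod_(i < n) \prod_(j < n | (i < j)%N) (a 0 (u j) - a 0 (u i)) =
  (-1) ^+ u * \prod_(i < n) \prod_(j < n | (i < j)%N) (a 0 j - a 0 i).
Proof.
have -> : \prod_(i < n) \prod_(j < n | (i < j)%N) (a 0 (u j) - a 0 (u i)) =
    \det (Vandermonde n (\row_j a 0 (u j))).
  by rewrite det_Vandermonde; do 2!apply: eq_bigr => ? _; rewrite !mxE.
have -> : Vandermonde n (\row_j a 0 (u j)) = col_perm u (Vandermonde n a).
  by apply/matrixP => i j; rewrite !mxE.
by rewrite col_permE det_mulmx det_perm odd_permV mulrC det_Vandermonde.
Qed.

(* Both sides are the sign of [\prod_(i < j) (w^-1 j - w^-1 i)]: on the left
   factor by factor, on the right as a permuted Vandermonde determinant. *)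
Lemma sign_perm_length (n : nat) (w : 'S_n) :
  (-1) ^+ perm_length w = (-1) ^+ w :> int.
Proof.
pose u := (w^-1)%g; pose x : 'rV[int]_n := \row_j (j : nat)%:Z.
have sg_prod (v : 'S_n) :
    Num.sg (\prod_(i < n) \prod_(j < n | (i < j)%N) (x 0 (v j) - x 0 (v i))) =
    (-1) ^+ #|[set p : 'I_n * 'I_n | (p.1 < p.2)%N && (v p.2 < v p.1)%N]|.
  rewrite pair_big_dep /=.
  rewrite (big_morph (@Num.sg int) (@Num.Theory.sgrM _) (@Num.Theory.sgr1 _)).
  rewrite -prodr_const (bigID (fun p : 'I_n * 'I_n => (v p.2 < v p.1)%N)) /=.
  rewrite [X in _ * X]big1 ?mulr1 => [|p /andP[lt_p]].
    apply: eq_big => [p|p /andP[_ lt_v]]; first by rewrite inE.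
    by rewrite Num.Theory.ltr0_sg // !mxE Num.Theory.subr_lt0 ltz_nat.
  rewrite -leqNgt leq_eqVlt => /orP[/eqP/val_inj/perm_inj eq_p|lt_v].
    by rewrite eq_p ltnn in lt_p.
  by rewrite Num.Theory.gtr0_sg // !mxE Num.Theory.subr_gt0 ltz_nat.
have sg_id :
    Num.sg (\prod_(i < n) \prod_(j < n | (i < j)%N) (x 0 j - x 0 i)) = 1.
  apply: Num.Theory.gtr0_sg; apply: Num.Theory.prodr_gt0 => i _.
  apply: Num.Theory.prodr_gt0 => j lt_ij.
  by rewrite !mxE Num.Theory.subr_gt0 ltz_nat.
rewrite /perm_length /inversions -/u -sg_prod det_Vandermonde_perm.
by rewrite Num.Theory.sgrM sg_id mulr1 Num.Theory.sgrX Num.Theory.sgrN1 /u odd_permV.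
Qed.

Lemma sum_ltn_const (n : nat) (u : 'S_n) (i : 'I_n) (c : nat) :
  (\sum_(j < n | u j < u i) c = c * u i)%N.
Proof.
rewrite (reindex_inj (@perm_inj _ u^-1%g)).
under eq_bigl do rewrite permKV.
by rewrite (big_ord_narrow (ltnW (ltn_ord _))) sum_nat_const card_ord mulnC.
Qed.

(** Each sum of products becomes a sum of [p.2] over the pairs ordered by [v], with [v] equal to [u]
    or to the identity. Pairs ordered alike by both cancel; the inversions remain on one side, their
    swaps on the other. *)
Lemma bigrassmannian_stat_sum (n : nat) (w : 'S_n) :
  (bigrassmannian_stat w + \sum_(i < n) i * (w^-1)%g i = \sum_(i < n) i * i)%N.
Proof.
set u := (w^-1)%g.
have sum_pairs (v : 'S_n) : (\sum_(i < n) i * v i =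
    \sum_(p : 'I_n * 'I_n | v p.1 < v p.2) p.2)%N.
  under eq_bigr => i _ do rewrite -sum_ltn_const.
  rewrite (exchange_big_dep predT) //= pair_big_dep /=.
  exact: eq_bigl.
have -> : (\sum_(i < n) i * i =
    \sum_(p : 'I_n * 'I_n | p.1 < p.2) p.2)%N.
  have := sum_pairs 1%g.
  under eq_bigr do rewrite perm1.
  by under [in RHS]eq_bigl do rewrite !perm1.
rewrite sum_pairs.
rewrite [in RHS](bigID (fun p : 'I_n * 'I_n => (u p.1 < u p.2)%N)) /=.
rewrite [X in (_ + X)%N](bigID (fun p : 'I_n * 'I_n => (p.1 < p.2)%N)) /=.
rewrite addnCA; congr (_ + _)%N; first by apply: eq_bigl => p; rewrite andbC.
have inv_bigl (p : 'I_n * 'I_n) :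
    ((p.1 < p.2) && ~~ (u p.1 < u p.2))%N = (p \in inversions w).
  rewrite inE -/u -leqNgt; apply: andb_id2l => lt_p.
  rewrite leq_eqVlt; case: eqP => // /val_inj/perm_inj eq_p.
  by rewrite eq_p ltnn in lt_p.
(* A swapped inversion contributes its smaller entry, so adding [p.2 - p.1] restores the larger
   one. *)
rewrite (reindex_inj (can_inj (@swap_pairK _ _))) /=.
rewrite [in RHS](eq_bigl _ _ inv_bigl).
rewrite (eq_bigl (mem (inversions w))) => [|p /=].
  rewrite /bigrassmannian_stat -big_split /=; apply: eq_bigr => p.
  by rewrite inE => /andP[/ltnW lt_p _]; rewrite subnK.
rewrite inE -/u -leqNgt andbC; apply: andb_id2r => lt_u.
rewrite leq_eqVlt; case: eqP => // /val_inj eq_p.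
by rewrite eq_p ltnn in lt_u.
Qed.

(** Replacing [w^-1 i] by its complement to [n.-1] makes the statistic appear with a plus sign,
    hence as an exponent of ['X]. *)
Lemma bigrassmannian_stat_rev (n : nat) (w : 'S_n) :
  (\sum_(i < n) i * (n.-1 - (w^-1)%g i) =
   \sum_(i < n) i * (n.-1 - i) + bigrassmannian_stat w)%N.
Proof.
have sum_rev (v : 'S_n) :
    (\sum_(i < n) i * (n.-1 - v i) + \sum_(i < n) i * v i =
     \sum_(i < n) i * n.-1)%N.
  rewrite -big_split; apply: eq_bigr => i _ /=; rewrite -mulnDr subnK //.
  by rewrite -ltnS (ltn_predK (ltn_ord i)).
apply/eqP; rewrite -(eqn_add2r (\sum_(i < n) i * (w^-1)%g i)) sum_rev.
rewrite -addnA bigrassmannian_stat_sum; apply/eqP.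
have := sum_rev 1%g; under eq_bigr do rewrite perm1.
by under [X in (_ + X)%N]eq_bigr do rewrite perm1.
Qed.

Lemma signed_bigrassmannian_poly_det (n : nat) :
  'X^(\sum_(i < n) i * (n.-1 - i)) * signed_bigrassmannian_poly n =
  \det (Vandermonde n (\row_(j < n) 'X^(n.-1 - j))) :> {poly int}.
Proof.
rewrite /signed_bigrassmannian_poly big_distrr /=.
(* The statistic involves [w^-1], whereas the Leibniz formula evaluates the permutation itself. *)
rewrite (reindex_inj (@invg_inj _)); apply: eq_bigr => s _.
have -> : (-1) ^+ perm_length s^-1%g = (-1) ^+ s :> {poly int}.
  have := congr1 (fun z : int => z%:~R : {poly int})
    (sign_perm_length _ s^-1%g).
  by rewrite !rmorphXn /= !rmorphN1 odd_permV.
rewrite mulrCA -exprD -bigrassmannian_stat_rev invgK; congr (_ * _).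
rewrite expr_sum; apply: eq_bigr => i _.
by rewrite !mxE -exprM mulnC.
Qed.

(** For fixed [j] the differences run over [1, ..., j], so [k] occurs once for each [j] with
    [k <= j < n]. *)
Lemma prod_pairs_sub (R : comNzRingType) (n : nat) (f : nat -> R) :
  \prod_(j < n) \prod_(i < n | (i < j)%N) f (j - i)%N =
  \prod_(1 <= k < n) f k ^+ (n - k).
Proof.
transitivity (\prod_(0 <= j < n) \prod_(1 <= k < j.+1) f k).
  rewrite big_mkord; apply: eq_bigr => j _.
  rewrite (big_ord_narrow (ltnW (ltn_ord j))) /= big_add1 /=.
  rewrite big_nat_rev big_mkord; apply: eq_bigr => i _; congr f.
  by rewrite add0n subnSK.
elim: n => [|n IHn]; first by rewrite !big_geq.
rewrite big_nat_recr //= IHn; case: n {IHn} => [|n].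
  by rewrite !big_geq ?mulr1.
(* The new largest [j] raises each old exponent by one and brings in one new factor with exponent
   1. *)
rewrite [X in _ * X]big_nat_recr //= [RHS]big_nat_recr //= mulrA -big_split /=.
rewrite subSnn expr1; congr (_ * _); apply: eq_big_nat => k /andP[_ lt_k].
by rewrite [in RHS]subSn 1?ltnW // exprSr.
Qed.

Theorem theorem3p12 (n : nat) (hn : (1 <= n)%N) :
  signed_bigrassmannian_poly n =
  \prod_(1 <= k < n) (1 - 'X^k) ^+ (n - k).
Proof.
pose C := (\sum_(i < n) i * (n.-1 - i))%N.
have X_C_neq0 : 'X^C != 0 :> {poly int} by rewrite monic_neq0 ?monicXn.
apply: (mulfI X_C_neq0); rewrite signed_bigrassmannian_poly_det det_Vandermonde.
rewrite (exchange_big_dep predT) //= -(prod_pairs_sub _ n (fun k => 1 - 'X^k)).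
rewrite /C expr_sum -big_split; apply: eq_bigr => j _ /=.
(* The monomial is shared out evenly, one copy of ['X^(n.-1 - j)] for each [i < j]. *)
have -> : 'X^(j * (n.-1 - j)) =
    \prod_(i < n | (i < j)%N) 'X^(n.-1 - j) :> {poly int}.
  rewrite (big_ord_narrow (ltnW (ltn_ord j))) prodr_const card_ord.
  by rewrite -exprM mulnC.
rewrite -big_split; apply: eq_bigr => i lt_ij /=.
rewrite !mxE mulrBr mulr1 -exprD addnBA 1?ltnW // subnK //.
by rewrite -ltnS prednK.
Qed.
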